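(* Let $m\in\mathbb{N}^*$, let $A_m=\Delta+\mu_m\mathbf{I}$ be the $N\times N$ matrix with $\mu_m=(m\pi/T)^2$, and let $i\neq j$ be two nodes in $\{1,\dots,N\}$. Assume that 1. the set $\{i,j\}$ is strategic; 2. the source signals $\lambda$ under consideration satisfy $\langle\lambda,\varphi_m\rangle_{L^2(0,T)}\neq 0$; 3. every $(N-2)\times(N-2)$ matrix obtained by removing from $A_m$ its $i$-th and $j$-th columns and any two rows is invertible. Then the observation operator $M[\lambda,S]=\{x_i(t),x_j(t);\ 0<t<T\}$ identifies uniquely the two unknown elements $S$ and $\lambda$ of the admissible set $\mathcal{A}$. That is, if $(\lambda^{(1)},S^{(1)})$ and $(\lambda^{(2)},S^{(2)})$ are two admissible pairs with $\langle\lambda^{(n)},\varphi_m\rangle_{L^2(0,T)}\ne 0$ for $n=1,2$, and the corresponding solutions $X^{(1)},X^{(2)}$ of the forced graph wave equation (with the same initial data $a,b$) satisfy $x^{(1)}_i(t)=x^{(2)}_i(t)$ and $x^{(1)}_j(t)=x^{(2)}_j(t)$ for all $t\in(0,T)$, then $S^{(1)}=S^{(2)}$ and $\lambda^{(1)}=\lambda^{(2)}$ in $L^2(0,T)$.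
   Context: Setting. Let $T>0$ and consider an undirected graph with $N$ nodes labelled $1,\dots,N$. Its graph Laplacian $\Delta$ is the real symmetric $N\times N$ matrix with $\Delta_{kl}=1$ if $k\ne l$ are joined by an edge, $\Delta_{kl}=0$ if $k\neq l$ are not joined, and $\Delta_{kk}=-\deg(k)$; it is negative semi-definite. Standing assumption: $\Delta$ has $N$ distinct eigenvalues $0=-\omega_1^2>-\omega_2^2>\dots>-\omega_N^2$. Let $v^1,\dots,v^N$ be an associated orthonormal basis of eigenvectors of $\mathbb{R}^N$, and write $v^n_k$ for the $k$-th component of $v^n$. $\mathbf{I}$ is the $N\times N$ identity matrix. Forced graph wave equation. For given fixed initial data $a,b\in\mathbb{R}^N$, the state $X=(x_1,\dots,x_N)^\top$, with $x_k\in H^2(0,T)$, is the unique solution of $\ddot X(t)-\Delta X(t)=\lambda(t)S$ in $(0,T)$, $X(0)=a$, $\dot X(0)=b$. Admissible set $\mathcal{A}$. The pair $(\lambda,S)$ is admissible if $\lambda\in L^2(0,T)$ and there exists $T^0\in(0,T)$ such that $\lambda(t)=0$ for all $t\in(T^0,T)$, and $S=(s_1,\dots,s_N)^\top$ with $s_k\in\{0,1\}$ for every $k$ and $\sum_{k=1}^N s_k=1$ (so $S$ is a standard basis vector, indicating the source node). Strategic set. A set of nodes $\{k_1,\dots,k_\ell\}$ is called strategic if for every $n=1,\dots,N$ there exists $k\in\{k_1,\dots,k_\ell\}$ such that $v^n_k\neq 0$. Eigenfunctions. For $m\in\mathbb{N}^*=\{1,2,\dots\}$, $\varphi_m(t)=\sqrt{2/T}\,\sin(m\pi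 t/T)$, which satisfies $-\ddot\varphi_m=\mu_m\varphi_m$ on $(0,T)$, $\varphi_m(0)=\varphi_m(T)=0$, with $\mu_m=(m\pi/T)^2$. Also $\langle f,g\rangle_{L^2(0,T)}=\int_0^T f(t)g(t)\,dt$. *)

(* Defs.v *)
From HB Require Import structures.
From mathcomp Require Import all_boot all_order all_algebra.
From mathcomp Require Import all_classical all_reals all_analysis.

Set Implicit Arguments.
Unset Strict Implicit.
Unset Printing Implicit Defensive.

Import Order.TTheory GRing.Theory Num.Theory.
Import numFieldNormedType.Exports.

Local Open Scope classical_set_scope.
Local Open Scope ring_scope.

Section Graph.
Context {R : realType} {N : nat}.

Definition simple_graph (e : rel 'I_N) : Prop :=
  symmetric e /\ irreflexive e.

Definition degree (e : rel 'I_N) (k : 'I_N) : nat := #|[set l | e k l]%SET|.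

Definition laplacian (e : rel 'I_N) : 'M[R]_N :=
  \matrix_(k, l) if k == l then - (degree e k)%:R else (e k l)%:R.

(* The eigenvalues are - omega n ^+ 2, listed in strictly decreasing order from
   0, so the basis v also witnesses that L has N distinct eigenvalues. *)
Definition spectral_basis (L : 'M[R]_N) (omega : 'I_N -> R)
    (v : 'I_N -> 'cV[R]_N) : Prop :=
  [/\ forall n : 'I_N, nat_of_ord n = 0%N -> - omega n ^+ 2 = 0,
      forall n p : 'I_N, (n < p)%N -> - omega p ^+ 2 < - omega n ^+ 2,
      forall n, L *m v n = (- omega n ^+ 2) *: v n &
      forall n p, \sum_k v n k ord0 * v p k ord0 = (n == p)%:R].

Definition strategic (v : 'I_N -> 'cV[R]_N) (K : {set 'I_N}) : Prop :=
  forall n, exists2 k, k \in K & v n k ord0 != 0.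

(* Rows and columns are removed one after the other: j' is the position of
   column j once column i is gone (lift i j' = j), and letting p' range over
   the N - 1 rows that remain after deleting row p covers every pair of
   distinct rows. *)
Definition two_row_minors_invertible (A : 'M[R]_N) (i j : 'I_N) : Prop :=
  forall j' : 'I_N.-1, lift i j' = j ->
  forall (p : 'I_N) (p' : 'I_N.-1),
    row' p' (row' p (col' j' (col' i A))) \in unitmx.

End Graph.

Section Wave.
Context {R : realType}.

(* Elements of L^2(0,T) are represented by functions on R, whose values outside
   ]0, T[ are irrelevant; equality in L^2(0,T) is equality a.e. on ]0, T[. *)
Definition L2 (T : R) (f : R -> R) : Prop :=
  (f \_ `]0, T[) \in Lfun (@lebesgue_measure R) 2%:E.

Definition ae_on (T : R) (P : R -> Prop) : Prop :=
  {ae @lebesgue_measure R, forall t, t \in `]0, T[ -> P t}.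

Definition inner (T : R) (f g : R -> R) : R :=
  \int[@lebesgue_measure R]_(t in `]0, T[) (f t * g t).

(* psi \in C^1_c(0,T) *)
Definition test_function (T : R) (psi : R -> R) : Prop :=
  [/\ forall t, derivable psi t 1,
      continuous (derive1 psi) &
      exists c d, [/\ 0 < c, d < T & forall t, psi t != 0 -> c <= t <= d]].

(* f \in H^1(0,T) with weak derivative g *)
Definition H1_derivative (T : R) (f g : R -> R) : Prop :=
  [/\ L2 T f, L2 T g &
      forall psi, test_function T psi ->
        inner T f (derive1 psi) = - inner T g psi].

(* Every component of X is in H^2(0,T), with first and second weak derivatives
   given by DX and DDX.  Since H^2(0,T) embeds in C^1([0,T]), X and DX are taken
   to be the continuous representatives on [0, T]; this gives a meaning to the
   initial conditions and to pointwise observations. *)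
Definition wave_solution (T : R) (N : nat) (L : 'M[R]_N) (a b : 'cV[R]_N)
    (lam : R -> R) (S : 'cV[R]_N) (X : R -> 'cV[R]_N) : Prop :=
  exists DX DDX : R -> 'cV[R]_N,
  [/\ forall k, H1_derivative T (fun t => X t k ord0) (fun t => DX t k ord0) /\
                H1_derivative T (fun t => DX t k ord0) (fun t => DDX t k ord0),
      forall k, {within `[0, T], continuous (fun t => X t k ord0)} /\
                {within `[0, T], continuous (fun t => DX t k ord0)},
      ae_on T (fun t => DDX t - L *m X t = lam t *: S) &
      X 0 = a /\ DX 0 = b].

Definition admissible (T : R) (N : nat) (lam : R -> R) (S : 'cV[R]_N) : Prop :=
  [/\ L2 T lam,
      exists T0, 0 < T0 < T /\ ae_on T (fun t => T0 < t -> lam t = 0),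
      forall k, S k ord0 = 0 \/ S k ord0 = 1 &
      \sum_k S k ord0 = 1].

Definition phi (T : R) (m : nat) (t : R) : R :=
  Num.sqrt (2 / T) * sin (m%:R * pi * t / T).

Definition mu (T : R) (m : nat) : R := (m%:R * pi / T) ^+ 2.

End Wave.

(* Main.v *)
Require Import Defs.
From HB Require Import structures.
From mathcomp Require Import all_boot all_order all_algebra.
From mathcomp Require Import all_classical all_reals all_analysis.
From mathcomp Require Import measurable_realfun ring lra.

Set Implicit Arguments.
Unset Strict Implicit.
Unset Printing Implicit Defensive.

Import Order.TTheory GRing.Theory Num.Theory.
Import numFieldNormedType.Exports.

Local Open Scope classical_set_scope.
Local Open Scope ring_scope.

(** The difference Z = X1 - X2 starts at rest, is unseen at i and j, and solves
    Z'' = L Z + F with F = lam1 S1 - lam2 S2.  Differentiating an unseen component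
    twice shows that the corresponding components of L Z, L^2 Z, ... are unseen
    as long as F is not, and for a strategic set a vector w with
    (L^k w)_i = (L^k w)_j = 0 for all k vanishes.

    After the sources are switched off this gives Z = 0, so Z(T) = 0 and testing
    the equation against phi_m leaves no boundary terms: the vector z of m-th
    sine coefficients of Z satisfies -(L + mu_m) z = <lam1, phi_m> S1 -
    <lam2, phi_m> S2 with z_i = z_j = 0.  If S1 and S2 were different basis
    vectors, the minor avoiding their two rows would force z = 0, hence
    <lam1, phi_m> = 0.

    Once S1 = S2 = S, let r be minimal with (L^r S)_o <> 0 for an o in {i, j}.
    Then (L^r Z)_o = 0 can still be differentiated twice and expresses
    lam1 - lam2 linearly through Z, so that Z solves an unforced linear system
    with zero initial data; thus Z = 0 and lam1 = lam2. *)

(** * Observability and minors *)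

Section SpectralBasis.
Context {R : realType} {N : nat}.
Context (L : 'M[R]_N) (omega : 'I_N -> R) (v : 'I_N -> 'cV[R]_N).
Context (hv : spectral_basis L omega v).

(** Orthonormality says that the square matrix [V] with rows [v n] satisfies [V *m V^T = 1]. Then
    [V^T *m V = 1] as well, and applied to [w] this is the expansion. *)
Lemma spectral_basis_expand (w : 'cV[R]_N) :
  w = \sum_n (\sum_k v n k ord0 * w k ord0) *: v n.
Proof.
have [_ _ _ ortho] := hv.
pose V : 'M[R]_N := \matrix_(n, k) v n k ord0.
have VVt : V *m V^T = 1%:M.
  apply/matrixP => n p; rewrite !mxE -ortho.
  by apply: eq_bigr => k _; rewrite !mxE.
have VtV : V^T *m V = 1%:M by exact: mulmx1C.
rewrite -[LHS]mul1mx -VtV -mulmxA.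
apply/colP => k; rewrite summxE mxE; apply: eq_bigr => n _.
rewrite !mxE mulrC; congr (_ * _).
by apply: eq_bigr => l _; rewrite !mxE.
Qed.

Lemma spectral_eigenvalue_inj (n p : 'I_N) :
  n != p -> - omega n ^+ 2 != - omega p ^+ 2.
Proof.
have [_ decr _ _] := hv; rewrite neq_ltn => /orP[np|pn].
- by rewrite gt_eqF// decr.
- by rewrite lt_eqF// decr.
Qed.

(* Applying L - mu_p for all p <> n isolates the n-th coefficient of w, which
   must then vanish as soon as one component of v n is nonzero. *)
Lemma invariant_strategic_eq0 (K : {set 'I_N}) (W : 'cV[R]_N -> Prop)
    (w : 'cV[R]_N) :
  strategic v K ->
  (forall u, W u -> forall k, k \in K -> u k ord0 = 0) ->
  (forall u c, W u -> W (L *m u - c *: u)) ->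
  W w -> w = 0.
Proof.
move=> hK WK WL Ww; have [_ _ eig _] := hv.
pose c n := \sum_k v n k ord0 * w k ord0.
pose lam n := - omega n ^+ 2.
have wE : w = \sum_n c n *: v n by exact: spectral_basis_expand.
have Ws (s : seq 'I_N) :
    W (\sum_n (c n * \prod_(p <- s) (lam n - lam p)) *: v n).
  elim: s => [|p s /(WL _ (lam p))].
    rewrite (eq_bigr (fun n => c n *: v n)) -?wE// => n _.
    by rewrite big_nil mulr1.
  congr W; rewrite mulmx_sumr scaler_sumr -sumrB; apply: eq_bigr => n _.
  rewrite -scalemxAr eig !scalerA -scalerBl big_cons; congr (_ *: _).
  by rewrite -/(lam n); ring.
rewrite wE big1// => n _.
have [k kK vnk0] := hK n.
have /WK/(_ _ kK) := Ws [seq p <- enum 'I_N | p != n].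
rewrite (bigD1 n)//= [X in _ + X]big1 => [|p pn]; last first.
  have pE : p \in [seq p <- enum 'I_N | p != n] by rewrite mem_filter pn mem_enum.
  rewrite (big_rem p pE) /= subrr mul0r mulr0.
  by rewrite scale0r.
rewrite addr0 mxE => /eqP; rewrite !mulf_eq0 (negbTE vnk0) orbF.
case/orP => [/eqP ->|]; first by rewrite scale0r.
rewrite prodf_seq_eq0 => /hasP[p]; rewrite mem_filter => /andP[pn _] /=.
by rewrite subr_eq0 (negbTE (spectral_eigenvalue_inj _))// eq_sym.
Qed.

(** [iter m (mulmx L) 1%:M] is the power [L^m]; in this form the linearity of matrix multiplication
    applies to iterates. *)
Lemma iter_mulmxE m (w : 'cV[R]_N) :
  iter m (mulmx L) w = iter m (mulmx L) 1%:M *m w.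
Proof.
by elim: m => [|m IH] /=; [rewrite mul1mx|rewrite IH mulmxA].
Qed.

(** The vectors whose whole [L]-orbit vanishes on [K] are stable under [L - c], because
    [L^m (L u - c u) = L^(m+1) u - c L^m u]. *)
Lemma strategic_observable (K : {set 'I_N}) (w : 'cV[R]_N) :
  strategic v K ->
  (forall m k, k \in K -> iter m (mulmx L) w k ord0 = 0) -> w = 0.
Proof.
move=> hK hw.
apply: (@invariant_strategic_eq0 K
  (fun u => forall m k, k \in K -> iter m (mulmx L) u k ord0 = 0)) => //.
- by move=> u /(_ 0%N).
- move=> u c Wu m k kK.
  have := Wu m.+1 k kK; rewrite iterSr => WLu.
  by rewrite iter_mulmxE mulmxBr -scalemxAr -!iter_mulmxE !mxE WLu Wu// mulr0 subrr.
Qed.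

End SpectralBasis.

(** Since [z] vanishes at [i] and [j], the rows of [A *m z] other than [p] and [q] are the minor
    applied to the remaining entries of [z]; invertibility kills these. *)
Lemma two_row_minors_eq0 {R : realType} {N : nat} (A : 'M[R]_N)
    (i j p q : 'I_N) (z : 'cV[R]_N) :
  i != j -> p != q -> two_row_minors_invertible A i j ->
  z i ord0 = 0 -> z j ord0 = 0 ->
  (forall k, k != p -> k != q -> (A *m z) k ord0 = 0) -> z = 0.
Proof.
move=> ij pq hA zi zj Az.
have [j' jE _] := unlift_some ij.
have [q' qE _] := unlift_some pq.
pose z' : 'cV[R]_(N.-1.-1) := row' j' (row' i z).
(* Splits off the [r]-th term of a sum; the existence of [r] forces [n] to be a successor. *)
have liftE (n : nat) (r : 'I_n) (F : 'I_n -> R) :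
    \sum_k F k = F r + \sum_k F (lift r k).
  by case: n r F => [[]//|n] r F; rewrite (bigD1_ord r).
have z'0 : z' = 0.
  apply: (can_inj (mulKmx (hA j' (esym jE) p q'))).
  rewrite mulmx0; apply/colP => k; rewrite !mxE.
  have : (A *m z) (lift p (lift q' k)) ord0 = 0.
    rewrite Az// 1?eq_sym ?neq_lift// qE.
    by rewrite (inj_eq lift_inj) neq_lift.
  rewrite mxE (liftE _ i) zi mulr0 add0r (liftE _ j') -jE zj mulr0 add0r => Az0.
  by rewrite -[RHS]Az0; apply: eq_bigr => l _; rewrite !mxE.
apply/colP => k; rewrite [RHS]mxE.
have [k' kE|->//] := unliftP i k.
have [k'' k'E|k'E] := unliftP j' k'; last by rewrite kE k'E -jE.
by have /colP/(_ k'') := z'0; rewrite !mxE -k'E -kE.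
Qed.

(** Some entry is 1, or the sum would be 0; the other entries are nonnegative with sum 0. *)
Lemma source_indicator {R : realType} {N : nat} (S : 'cV[R]_N) :
  (forall k, S k ord0 = 0 \/ S k ord0 = 1) -> \sum_k S k ord0 = 1 ->
  exists p, S = delta_mx p ord0.
Proof.
move=> S01 S1.
have S0 k : 0 <= S k ord0 by case: (S01 k) => ->.
have [p Sp] : exists p, S p ord0 = 1.
  apply/not_existsP => nS; move: S1; rewrite big1 => [/esym/eqP|k _].
    by rewrite oner_eq0.
  by case: (S01 k) => // /nS.
exists p; apply/colP => k; rewrite mxE eqxx andbT.
have [->//|kp] := eqVneq k p.
move: S1; rewrite (bigD1 p)//= Sp => /(canRL (addKr _)); rewrite addNr => /eqP.
by rewrite psumr_eq0// => /allP /(_ k); rewrite mem_index_enum kp /= => /(_ _)/eqP ->.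
Qed.

(** * Smooth cutoffs *)

Section DerivativeRules.
Context {R : realType}.
Implicit Types x : R.

Lemma is_derive_mulr (f g : R -> R) (df dg : R) x :
  is_derive x 1 f df -> is_derive x 1 g dg ->
  is_derive x 1 (fun y => f y * g y) (f x * dg + df * g x).
Proof.
by move=> hf hg; apply: (is_derive_eq (is_deriveM hf hg)); rewrite (mulrC df).
Qed.

Lemma is_derive_continuous (f df : R -> R) :
  (forall x, is_derive x 1 f (df x)) -> continuous f.
Proof.
move=> hf x; apply: differentiable_continuous; apply/derivable1_diffP.
by have /@ex_derive := hf x.
Qed.

End DerivativeRules.

Section Cutoff.
Context {R : realType}.
Implicit Types x c h : R.

(** Test functions only have to be of class C^1, so the squared positive part is smooth enough to
    build cutoffs from. *)
Definition sqpos x : R := Num.max x 0 ^+ 2.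

Lemma continuous_maxr0 : continuous (fun x : R => Num.max x 0).
Proof. by move=> x; apply: continuous_max => //; exact: cvg_cst. Qed.

Lemma is_derive_sqpos x : is_derive x 1 sqpos (2 * Num.max x 0).
Proof.
suff lim : h^-1 *: (sqpos (h *: 1 + x) - sqpos x) @[h --> 0^'] -->
    2 * Num.max x 0.
  by apply: DeriveDef; [apply/cvg_ex; exists (2 * Num.max x 0)|exact: cvg_lim].
apply/cvgrPdist_le => e e0; near=> h.
have h0 : h != 0 by near: h; exact: nbhs_dnbhs_neq.
have he : `|h| <= e by near: h; exact: dnbhs0_le.
(* After multiplication by [|h|] the claim is that the first-order Taylor remainder of [sqpos] is at
   most [h ^+ 2], checked on the signs of [x] and [h + x]. *)
apply: le_trans he; rewrite -(ler_pM2l (_ : 0 < `|h|)) ?normr_gt0//.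
rewrite -normrM mulrBr /GRing.scale /= mulr1 (mulVKf h0) -normrM -expr2.
rewrite ger0_norm ?sqr_ge0// ler_norml /sqpos.
by case: (leP x 0) => ?; case: (leP (h + x) 0) => ?; apply/andP; split; nra.
Unshelve. all: by end_near. Qed.

(* Of class C^1, from 0 on x <= 0 to 1 on x >= 1. *)
Definition ramp x : R := 1 - sqpos (1 - sqpos x).

Definition dramp x : R := 4 * Num.max (1 - sqpos x) 0 * Num.max x 0.

Lemma is_derive_ramp x : is_derive x 1 ramp (dramp x).
Proof.
have d1 := is_derive_sqpos x.
have d2 : is_derive x 1 (fun y => 1 - sqpos y) (- (2 * Num.max x 0)).
  have := is_deriveB (is_derive_cst (1 : R) x 1) d1.
  by rewrite sub0r.
have d3 := is_derive_sqpos (1 - sqpos x).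
have d4 := @is_derive1_comp _ sqpos (fun y => 1 - sqpos y) x _ _ d3 d2.
have d5 := is_deriveB (is_derive_cst (1 : R) x 1) d4.
by apply: (is_derive_eq d5); rewrite /dramp; ring.
Qed.

Lemma continuous_dramp : continuous dramp.
Proof.
move=> x; apply: cvgM; last exact: continuous_maxr0.
apply: cvgM; first exact: cvg_cst.
apply: (@continuous_comp _ _ _ (fun y => 1 - sqpos y) (fun y => Num.max y 0)).
  apply: cvgB; first exact: cvg_cst.
  exact: (cvgM (@continuous_maxr0 x) (@continuous_maxr0 x)).
exact: continuous_maxr0.
Qed.

Lemma ramp_le0 x : x <= 0 -> ramp x = 0.
Proof.
move=> x0; rewrite /ramp /sqpos (max_idPr x0) expr0n/= subr0.
by rewrite (max_idPl ler01) expr1n subrr.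
Qed.

Lemma ramp_ge1 x : 1 <= x -> ramp x = 1.
Proof.
move=> x1; rewrite /ramp {1}/sqpos (max_idPr _) ?expr0n ?subr0//.
by rewrite subr_le0 /sqpos (max_idPl _) ?(le_trans ler01)// exprn_ege1.
Qed.

Lemma ramp_itv x : 0 <= ramp x <= 1.
Proof.
have : 0 <= sqpos x by exact: sqr_ge0.
rewrite /ramp; move: (sqpos x) => y y0; rewrite /sqpos.
by case: (leP (1 - y) 0) => ?; apply/andP; split; nra.
Qed.

Lemma dramp_ge0 x : 0 <= dramp x.
Proof. by rewrite /dramp !mulr_ge0// le_max lexx orbT. Qed.

Lemma dramp_le0 x : x <= 0 -> dramp x = 0.
Proof. by move=> x0; rewrite /dramp (max_idPr x0) mulr0. Qed.

Lemma dramp_ge1 x : 1 <= x -> dramp x = 0.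
Proof.
move=> x1; rewrite /dramp (max_idPr _) ?mulr0 ?mul0r//.
by rewrite subr_le0 /sqpos (max_idPl _) ?(le_trans ler01)// exprn_ege1.
Qed.

Definition step c h x : R := ramp ((x - c) / h).

(** For [0 < h] this is a nonnegative bump on [[c, c + h]] of integral 1, the total increment of
    [step c h]. It serves as an averaging kernel. *)
Definition dstep c h x : R := h^-1 * dramp ((x - c) / h).

Lemma is_derive_step c h x : is_derive x 1 (step c h) (dstep c h x).
Proof.
have d1 : is_derive x 1 (fun y => (y - c) / h) (h^-1).
  have d0 := is_deriveM (is_deriveB (is_derive_id x (1 : R))
    (is_derive_cst c x (1 : R))) (is_derive_cst h^-1 x (1 : R)).
  apply: (is_derive_eq d0).
  by rewrite subr0 /GRing.scale/= mulr0 add0r mulr1.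
have d2 := @is_derive1_comp _ ramp (fun y => (y - c) / h) x _ _
  (is_derive_ramp ((x - c) / h)) d1.
apply: (is_derive_eq d2).
by rewrite mulrC.
Qed.

Lemma continuous_step c h : continuous (step c h).
Proof. exact: is_derive_continuous (is_derive_step c h). Qed.

Lemma continuous_dstep c h : continuous (dstep c h).
Proof.
move=> x; apply: cvgM; first exact: cvg_cst.
apply: (@continuous_comp _ _ _ (fun y => (y - c) / h) dramp).
  by apply: cvgMl; apply: cvgB => //; exact: cvg_cst.
exact: continuous_dramp.
Qed.

Lemma dstep_ge0 c h x : 0 < h -> 0 <= dstep c h x.
Proof. by move=> h0; rewrite mulr_ge0 ?dramp_ge0// invr_ge0 ltW. Qed.

Lemma dstep_eq0 c h x : 0 < h -> ~~ (c < x < c + h) -> dstep c h x = 0.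
Proof.
move=> h0; rewrite negb_and -!leNgt => /orP[xc|xch]; rewrite /dstep.
- by rewrite dramp_le0 ?mulr0// pmulr_lle0 ?invr_gt0// subr_le0.
- by rewrite dramp_ge1 ?mulr0// ler_pdivlMr// mul1r lerBrDl.
Qed.

Lemma step_le c h x : 0 < h -> x <= c -> step c h x = 0.
Proof.
by move=> h0 xc; rewrite /step ramp_le0// pmulr_lle0 ?invr_gt0// subr_le0.
Qed.

Lemma step_ge c h x : 0 < h -> c + h <= x -> step c h x = 1.
Proof.
by move=> h0 xch; rewrite /step ramp_ge1// ler_pdivlMr// mul1r lerBrDl.
Qed.

End Cutoff.

(** * Weak derivatives and primitives *)

Section IntervalIntegrals.
Context {R : realType}.
Notation mu := (@lebesgue_measure R).
Implicit Types (T s t x : R) (f g u : R -> R).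

Lemma within_continuousM (A : set R) f g :
  {within A, continuous f} -> {within A, continuous g} ->
  {within A, continuous (fun x => f x * g x)}.
Proof. by move=> cf cg x; apply: cvgM; [exact: cf|exact: cg]. Qed.

Lemma integrable_itvS (i j : interval R) f :
  [set` i] `<=` [set` j] -> mu.-integrable [set` j] (EFin \o f) ->
  mu.-integrable [set` i] (EFin \o f).
Proof. by move=> ij; apply: integrableS => //; exact: measurable_itv. Qed.

Lemma integrable_oo_continuous s t f :
  {within `[s, t], continuous f} -> mu.-integrable `]s, t[ (EFin \o f).
Proof.
move=> cf; apply: (integrable_itvS (@subset_itv_oo_cc _ _ s t)).
by apply: continuous_compact_integrable => //; exact: segment_compact.
Qed.

Lemma integrable_oo_mul s t g u :
  mu.-integrable `]s, t[ (EFin \o g) -> {within `[s, t], continuous u} ->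
  mu.-integrable `]s, t[ (EFin \o (fun x => g x * u x)).
Proof.
move=> ig cu.
apply: (integrableMl _ ig) => //.
  apply: subspace_continuous_measurable_fun => //.
  by apply: continuous_subspaceW cu; exact: subset_itv_oo_cc.
have /compact_bounded[M [_ mrt]] :=
  continuous_compact cu (@segment_compact _ s t).
exists M; split; rewrite ?num_real // => y My x xst; apply: mrt => //.
by exists x => //; exact: subset_itv_oo_cc.
Qed.

Lemma dominated_cvg_Rintegral (D : set R) (f_ : nat -> R -> R) f g :
  measurable D ->
  (forall n, measurable_fun D (f_ n)) ->
  (forall x, D x -> f_ n x @[n --> \oo] --> f x) ->
  mu.-integrable D (EFin \o g) ->
  (forall n x, D x -> `|f_ n x| <= g x) ->
  \int[mu]_(x in D) f_ n x @[n --> \oo] --> \int[mu]_(x in D) f x.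
Proof.
move=> mD mf ff ig fg.
have mf' n : measurable_fun D (EFin \o f_ n) by exact/measurable_EFinP.
have ff' x : D x -> (EFin \o f_ n) x @[n --> \oo] --> (EFin \o f) x.
  by move=> Dx; apply: cvg_EFin; [exact: nearW|exact: ff].
have mflim : measurable_fun D (EFin \o f) by exact: (emeasurable_fun_cvg _ _ mf' ff').
have [||intf _ lim] := @dominated_convergence _ _ _ mu D mD
  (fun n => EFin \o f_ n) (EFin \o f) (EFin \o g) mf' mflim _ ig _.
- exact: aeW.
- by apply: aeW => x n Dx; rewrite /= lee_fin fg.
apply: fine_cvg; rewrite fineK//.
exact: integrable_fin_num.
Qed.

Lemma Rintegral_oo_derive s t f g : s < t ->
  (forall x, is_derive x 1 f (g x)) -> continuous g ->
  \int[mu]_(x in `]s, t[) g x = f t - f s.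
Proof.
move=> st df cg.
have cf := is_derive_continuous df.
have icg : mu.-integrable `]s, t[ (EFin \o g).
  by apply: integrable_oo_continuous; exact: continuous_subspaceT.
rewrite Rintegral_itv_bndo_bndc// Rintegral_itv_obnd_cbnd; last first.
  apply: (integrable_itvS (@subset_itv_oc_cc _ _ s t)).
  apply: continuous_compact_integrable; first exact: segment_compact.
  exact: continuous_subspaceT.
rewrite /Rintegral (@continuous_FTC2 _ g f)//.
- exact: continuous_subspaceT.
- split.
  + by move=> x _; have /@ex_derive := df x.
  + exact: cvg_at_right_filter (cf s).
  + exact: cvg_at_left_filter (cf t).
- by move=> x _; rewrite derive1E; exact: derive_val.
Qed.

End IntervalIntegrals.

Lemma within_continuous_near {R : realType} (A : set R) (f : R -> R) (a e : R) :
  {within A, continuous f} -> A a -> 0 < e ->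
  \forall x \near a, A x -> `|f a - f x| <= e.
Proof.
move=> cf Aa e0; have /cvgrPdist_le/(_ e e0) := cf a.
by rewrite /prop_near1 /nbhs/= -nbhs_subspace_in.
Qed.

Section WeakDerivative.
Context {R : realType}.
Notation mu := (@lebesgue_measure R).
Implicit Types (T s t x : R) (f g u : R -> R).

(** The interval is bounded, so the constant 1 is in L^2 and [f = f * 1] is integrable as a product
    of two L^2 functions. *)
Lemma L2_integrable T f : L2 T f -> mu.-integrable `]0, T[ (EFin \o f).
Proof.
move=> f2.
have f1 : L2 T (cst 1).
  rewrite /L2 inE/=; apply/andP; split; rewrite inE/=.
    exact/(measurable_restrictT _ _).1.
  rewrite /finite_norm unlock poweR_lty//.
  set D := [set` `]0, T[]; pose one : R -> R := cst 1.
  have -> : (fun x => `|(EFin \o (one \_ D)) x| `^ 2)%E = (EFin \o one) \_ D.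
    apply/funext => x; rewrite /= !patchE; case: ifP => _ /=.
      by rewrite normr1 powR1.
    by rewrite normr0 powR0.
  rewrite -integral_mkcond -[EFin \o one]/(cst 1%:E) integral_cst;
    last exact: measurable_itv.
  rewrite mul1e; suff muD : (mu D < +oo)%E by exact: muD.
  by rewrite /D lebesgue_measure_itv/=; case: ifP => // _; rewrite oppr0 adde0 ltry.
have /Lfun1_integrable := Lfun2_mul_Lfun1 f2 f1.
move=> fi; apply/integrable_mkcond => //.
apply: eq_integrable fi => // x _; rewrite /= !patchE.
by case: ifP => _ /=; rewrite ?mulr1 ?mulr0.
Qed.

(** The kernels have integral 1 and supports inside [[0, T]] shrinking to [a], so the integrals are
    averages of values of [f] close to [f a]. The point [a] may be an endpoint. *)
Lemma cvg_Rintegral_dstep T f (a : R) (c h : nat -> R) :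
  {within `[0, T], continuous f} -> a \in `[0, T] ->
  (forall n, 0 < h n) -> (forall n, 0 <= c n) -> (forall n, c n + h n <= T) ->
  c n @[n --> \oo] --> a -> h n @[n --> \oo] --> (0 : R) ->
  \int[mu]_(x in `]0, T[) (f x * dstep (c n) (h n) x) @[n --> \oo] --> f a.
Proof.
move=> cf aT h0 c0 chT ca h_0; have T0 : 0 < T.
  by rewrite (lt_le_trans _ (chT 0%N))// ltr_wpDl.
have cw n : {within `[0, T], continuous (dstep (c n) (h n))}.
  by apply: continuous_subspaceT; exact: continuous_dstep.
have W n : \int[mu]_(x in `]0, T[) dstep (c n) (h n) x = 1.
  rewrite (Rintegral_oo_derive T0 (is_derive_step (c n) (h n))
    (continuous_dstep (h := h n))).
  by rewrite step_ge// step_le// subr0.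
apply/cvgrPdist_le => e e0.
have [d /= d0 fd] := within_continuous_near cf aT e0.
have d20 : 0 < d / 2 by rewrite divr_gt0.
near=> n.
(* With the center and the width both below [d / 2], the support lies within distance [d] of [a]. *)
have cn : `|a - c n| < d / 2 by near: n; exact: (cvgrPdist_lt _ _).1.
have hn : h n < d / 2.
  rewrite -[ltLHS]gtr0_norm//; near: n.
  by have /cvgrPdist_lt/(_ _ d20) := h_0; apply: filterS => n; rewrite sub0r normrN.
have ifw : mu.-integrable `]0, T[ (EFin \o (fun x => f x * dstep (c n) (h n) x)).
  by apply: integrable_oo_continuous; exact: within_continuousM.
have iw : mu.-integrable `]0, T[ (EFin \o dstep (c n) (h n)).
  exact: integrable_oo_continuous.
have iZ r : mu.-integrable `]0, T[ (EFin \o (fun x => r * dstep (c n) (h n) x)).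
  apply: integrable_oo_continuous; apply: within_continuousM => //.
  exact: cst_continuous.
(* Both [f a] and [e] are written as integrals against the kernel, which reduces the bound to a
   pointwise one on its support. *)
have -> : f a = \int[mu]_(x in `]0, T[) (f a * dstep (c n) (h n) x).
  by rewrite RintegralZl// W mulr1.
rewrite -(RintegralB _ (iZ _) ifw)//.
have -> : e = \int[mu]_(x in `]0, T[) (e * dstep (c n) (h n) x).
  by rewrite RintegralZl// W mulr1.
have ifB : mu.-integrable `]0, T[
    (EFin \o (fun x => f a * dstep (c n) (h n) x - f x * dstep (c n) (h n) x)).
  apply: integrable_oo_continuous; apply: within_continuousB.
    by apply: within_continuousM => //; exact: cst_continuous.
  exact: within_continuousM.
apply: le_trans (le_normr_Rintegral _ ifB) _ => //.
apply: le_Rintegral => //; first exact: integrable_norm.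
move=> x xT; rewrite -mulrBl normrM (ger0_norm (dstep_ge0 _ _ (h0 n))).
have [xc|xc] := boolP (c n < x < c n + h n); last first.
  by rewrite (dstep_eq0 _ xc)// !mulr0.
apply: ler_wpM2r; first exact: dstep_ge0.
apply: fd; last exact: subset_itv_oo_cc.
rewrite /ball/=; move: cn xc; rewrite ltr_norml => /andP[? ?] /andP[? ?].
by rewrite ltr_norml; apply/andP; split; lra.
Unshelve. all: by end_near. Qed.

(** Testing against trapezoids that tend to the indicator of []s, t[] turns one side into averages
    of [f] near [s] and [t], and the other into the integral of [g]. *)
Lemma weak_derivative_FTC T f g s t :
  {within `[0, T], continuous f} -> mu.-integrable `]0, T[ (EFin \o g) ->
  (forall psi, test_function T psi -> inner T f (derive1 psi) = - inner T g psi) ->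
  0 <= s -> s < t -> t <= T ->
  f t - f s = \int[mu]_(x in `]s, t[) g x.
Proof.
move=> cf ig fg s0 st tT.
have T0 : 0 < T by rewrite (lt_le_trans _ tT)// (le_lt_trans s0).
(* psi n rises from 0 to 1 on [s + h n, s + 2 h n] and falls back to 0 on
   [t - 2 h n, t - h n], so that f is averaged near s and near t. *)
pose h n : R := (t - s) / 4 / n.+1%:R.
have h0 n : 0 < h n by rewrite !divr_gt0 ?subr_gt0.
(* The rise ends at [s + 2 h] and the fall starts at [t - 2 h], so this keeps them disjoint. *)
have h4 n : 4 * h n <= t - s.
  rewrite /h mulrA mulrCA divff// mulr1 ler_pdivrMr// ler_peMr ?ler1n//.
  by rewrite subr_ge0 ltW.
have h_0 : h n @[n --> \oo] --> (0 : R).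
  rewrite -[X in _ --> X](mulr0 ((t - s) / 4)); apply: cvgM; first exact: cvg_cst.
  exact: cvg_harmonic.
pose c1 n := s + h n; pose c2 n := t - 2 * h n.
pose psi n x := step (c1 n) (h n) x - step (c2 n) (h n) x.
pose dpsi n x := dstep (c1 n) (h n) x - dstep (c2 n) (h n) x.
have dpsiE n x : is_derive x 1 (psi n) (dpsi n x).
  have d1 := is_derive_step (c1 n) (h n) x.
  have d2 := is_derive_step (c2 n) (h n) x.
  exact: is_deriveB d1 d2.
have D1 n : derive1 (psi n) = dpsi n.
  by apply/funext => x; rewrite derive1E; apply: derive_val.
have psi_out n x : x <= c1 n \/ c2 n + h n <= x -> psi n x = 0.
  have := h4 n; have := h0 n; rewrite /psi /c1 /c2 => hn0 hn4 [xs|xt].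
  - by rewrite !step_le ?subrr//; lra.
  - by rewrite !step_ge ?subrr//; lra.
have psi_in n x : c1 n + h n <= x -> x <= c2 n -> psi n x = 1.
  by move=> cx xc; rewrite /psi step_ge// step_le// subr0.
have tpsi n : test_function T (psi n).
  split.
  - by move=> x; have /@ex_derive := dpsiE n x.
  - rewrite D1 => x; apply: cvgB; exact: continuous_dstep.
  (* The margin [h n] at either end makes the support compact in []0, T[] even when [s = 0] or
     [t = T]. *)
  - have := h0 n => hn0; exists (c1 n), (c2 n + h n); split.
    + by rewrite /c1; lra.
    + by rewrite /c2; lra.
    + move=> x; apply: contra_neqT => xn; apply: psi_out.
      by move: xn; rewrite negb_and -!ltNge => /orP[/ltW|/ltW]; [left|right].
have cpsi n : {within `[0, T], continuous (psi n)}.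
  apply: continuous_subspaceT => x.
  by apply: cvgB; exact: continuous_step.
have lim1 : inner T f (derive1 (psi n)) @[n --> \oo] --> f s - f t.
  have -> : (fun n => inner T f (derive1 (psi n))) =
      (fun n => \int[mu]_(x in `]0, T[) (f x * dstep (c1 n) (h n) x) -
                \int[mu]_(x in `]0, T[) (f x * dstep (c2 n) (h n) x)).
    apply/funext => n; rewrite D1 -RintegralB//; last 2 first.
    - apply: integrable_oo_continuous; apply: within_continuousM => //.
      by apply: continuous_subspaceT; exact: continuous_dstep.
    - apply: integrable_oo_continuous; apply: within_continuousM => //.
      by apply: continuous_subspaceT; exact: continuous_dstep.
    by apply: eq_Rintegral => x _; rewrite /dpsi mulrBr.
  apply: cvgB; apply: cvg_Rintegral_dstep => //.
  - by rewrite in_itv/= s0 (le_trans (ltW st)).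
  - by move=> n; rewrite /c1 addr_ge0// ltW.
  - by move=> n; have := h4 n; have := h0 n; rewrite /c1; lra.
  - by rewrite -[X in _ --> X]addr0; apply: cvgD => //; exact: cvg_cst.
  - by rewrite in_itv/= tT andbT ltW// (le_lt_trans s0).
  - by move=> n; have := h4 n; have := h0 n; rewrite /c2; lra.
  - by move=> n; have := h4 n; have := h0 n; rewrite /c2; lra.
  - rewrite -[X in _ --> X]subr0 -[X in _ - X](mulr0 2).
    by apply: cvgB; [exact: cvg_cst|apply: cvgM => //; exact: cvg_cst].
have lim2 : inner T g (psi n) @[n --> \oo] --> \int[mu]_(x in `]s, t[) g x.
  have -> : \int[mu]_(x in `]s, t[) g x = \int[mu]_(x in `]0, T[) (g \_ `]s, t[) x.
    rewrite -Rintegral_mkcondr; congr Rintegral; rewrite setIidr//.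
    by apply: subset_itvSoo; rewrite bnd_simp.
  (* The trapezoids are bounded by 1 in absolute value, and at each point the sequence is eventually
     equal to its limit. *)
  apply: (@dominated_cvg_Rintegral _ _ _ _ (fun x => `|g x|)) => //.
  - move=> n; have /integrableP[/measurable_EFinP//] := integrable_oo_mul ig (cpsi n).
  - move=> x _; rewrite patchE; case: ifPn => [|].
      rewrite inE/= in_itv/= => /andP[sx xt].
      apply: cvg_near_cst; near=> n.
      have hn : h n < Num.min (x - s) (t - x) / 2.
        rewrite -[ltLHS]gtr0_norm//; near: n.
        have m0 : 0 < Num.min (x - s) (t - x) / 2.
          by rewrite divr_gt0// lt_min !subr_gt0 sx.
        have /cvgrPdist_lt/(_ _ m0) := h_0.
        by apply: filterS => n; rewrite sub0r normrN.
      have [hn1 hn2] : 2 * h n < x - s /\ 2 * h n < t - x.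
        by move: hn; case: (leP (x - s) (t - x)) => ? ?; split; lra.
      by rewrite psi_in ?mulr1//; rewrite /c1 /c2; lra.
    rewrite notin_setE/= in_itv/= => /negP; rewrite negb_and -!leNgt => xst.
    apply: cvg_near_cst; apply: nearW => n; rewrite psi_out ?mulr0//.
    have := h0 n => hn0; rewrite /c1 /c2.
    by case/orP: xst => ?; [left|right]; lra.
  - exact: integrable_norm.
  - move=> n x _; rewrite normrM ler_piMr// ler_norml /psi.
    have := ramp_itv ((x - c1 n) / h n); have := ramp_itv ((x - c2 n) / h n).
    rewrite /step => /andP[? ?] /andP[? ?].
    by apply/andP; split; lra.
have {}lim1 : - inner T g (psi n) @[n --> \oo] --> f s - f t.
  by under eq_fun do rewrite -fg//.
have /(cvg_unique (@Rhausdorff R) lim1) : - inner T g (psi n) @[n --> \oo] -->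
    - \int[mu]_(x in `]s, t[) g x by exact: cvgN.
by move=> /(congr1 -%R); rewrite opprK opprB.
Unshelve. all: by end_near. Qed.

End WeakDerivative.

(** * Integration by parts, primitives and linear differential systems *)

Section Primitives.
Context {R : realType}.
Notation mu := (@lebesgue_measure R).
Implicit Types (T s t x : R) (f g u : R -> R).

Lemma is_derive_finsum (I : finType) (h dh : I -> R -> R) x :
  (forall k, is_derive x 1 (h k) (dh k x)) ->
  is_derive x 1 (fun y => \sum_k h k y) (\sum_k dh k x).
Proof.
move=> hd; have -> : (fun y => \sum_k h k y) = \sum_k h k.
  by apply/funext => y; rewrite fct_sumE.
apply: (big_ind2 (fun F d => is_derive x 1 F d)) => //.
- exact: is_derive_cst.
- by move=> F d G d' hF hG; exact: is_deriveD.
Qed.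

Lemma within_continuous_sum (I : Type) (r : seq I) (A : set R) (f : I -> R -> R) :
  (forall k, {within A, continuous (f k)}) ->
  {within A, continuous (fun x => \sum_(k <- r) f k x)}.
Proof.
move=> cf; elim: r => [|k r IH].
  rewrite (_ : (fun x => _) = cst 0); first exact: cst_continuous.
  by apply/funext => x; rewrite big_nil.
rewrite (_ : (fun x => _) = (fun x => f k x + \sum_(k <- r) f k x)).
  exact: within_continuousD.
by apply/funext => x; rewrite big_cons.
Qed.

(** The product [f * phi] has weak derivative [f * dphi + g * phi], as is seen by testing [f]
    against [phi * psi], again a test function; the integral of this derivative gives the boundary
    terms. *)
Lemma weak_derivative_by_parts T f g (phi dphi : R -> R) : 0 < T ->
  {within `[0, T], continuous f} -> mu.-integrable `]0, T[ (EFin \o g) ->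
  (forall psi, test_function T psi -> inner T f (derive1 psi) = - inner T g psi) ->
  (forall x, is_derive x 1 phi (dphi x)) -> continuous dphi ->
  inner T f dphi + inner T g phi = f T * phi T - f 0 * phi 0.
Proof.
move=> T0 cf ig fg hphi cdphi.
have cphi := is_derive_continuous hphi.
have cphiT := @continuous_subspaceT _ _ `[0, T] _ cphi.
have cdphiT := @continuous_subspaceT _ _ `[0, T] _ cdphi.
have i1 : mu.-integrable `]0, T[ (EFin \o (fun x => f x * dphi x)).
  by apply: integrable_oo_continuous; exact: within_continuousM.
have i2 := integrable_oo_mul ig cphiT.
rewrite /inner -RintegralD//.
apply/esym; apply: (@weak_derivative_FTC _ T (fun x => f x * phi x)
  (fun x => f x * dphi x + g x * phi x) 0 T) => //.
- exact: within_continuousM.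
- exact: (@integrableD _ _ _ mu `]0, T[ _ _ _ i1 i2).
move=> psi [dpsi cdpsi [c [d [c0 dT psi0]]]].
have hpsi x : is_derive x 1 psi (derive1 psi x).
  by rewrite derive1E; exact: derivableP.
have cpsi := is_derive_continuous hpsi.
have hprod x := is_derive_mulr (hphi x) (hpsi x).
have prodE : derive1 (fun y => phi y * psi y) =
    (fun x => phi x * derive1 psi x + dphi x * psi x).
  by apply/funext => x; rewrite derive1E; exact: derive_val.
have tprod : test_function T (fun y => phi y * psi y).
  split.
  - by move=> x; have /@ex_derive := hprod x.
  - rewrite prodE => x; apply: cvgD; apply: cvgM;
      by [exact: cphi|exact: cdpsi|exact: cdphi|exact: cpsi].
  - exists c, d; split => // x; rewrite mulf_eq0 negb_or => /andP[_]; exact: psi0.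
have cpsiT := @continuous_subspaceT _ _ `[0, T] _ cpsi.
have cdpsiT := @continuous_subspaceT _ _ `[0, T] _ cdpsi.
have j1 : mu.-integrable `]0, T[ (EFin \o (fun x => f x * phi x * derive1 psi x)).
  by apply: integrable_oo_continuous; do 2 apply: within_continuousM => //.
have j2 := integrable_oo_mul i1 cpsiT.
have j3 := integrable_oo_mul i2 cpsiT.
have := fg _ tprod; rewrite prodE /inner.
under eq_Rintegral do rewrite mulrDr !mulrA.
rewrite RintegralD// => /(canRL (addrK _)) ->.
under [X in - X - _]eq_Rintegral do rewrite mulrA.
under [X in _ = - X]eq_Rintegral do rewrite mulrDl.
by rewrite RintegralD// opprD addrC.
Qed.

(** The integral form of the weak derivative: free of test functions and stable under linear
    combinations. *)
Definition primitive_on T f g :=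
  [/\ {within `[0, T], continuous f}, mu.-integrable `]0, T[ (EFin \o g) &
      forall s t, 0 <= s -> s < t -> t <= T ->
        f t - f s = \int[mu]_(x in `]s, t[) g x].

Lemma H1_derivative_primitive T f g :
  {within `[0, T], continuous f} -> H1_derivative T f g -> primitive_on T f g.
Proof.
move=> cf [_ /L2_integrable ig fg]; split => // s t s0 st tT.
exact: weak_derivative_FTC fg _ _ _.
Qed.

Lemma primitive_onB T f1 g1 f2 g2 :
  primitive_on T f1 g1 -> primitive_on T f2 g2 ->
  primitive_on T (fun x => f1 x - f2 x) (fun x => g1 x - g2 x).
Proof.
move=> [c1 i1 e1] [c2 i2 e2]; split.
- exact: within_continuousB.
- exact: (@integrableB _ _ _ mu `]0, T[ _ _ _ i1 i2).
move=> s t s0 st tT.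
have sub : `]s, t[ `<=` `]0, T[ by apply: subset_itvSoo; rewrite bnd_simp.
rewrite RintegralB//; last 2 first.
- exact: integrable_itvS sub i1.
- exact: integrable_itvS sub i2.
by rewrite -e1// -e2//; ring.
Qed.

Lemma primitive_onZ T (c : R) f g : primitive_on T f g ->
  primitive_on T (fun x => c * f x) (fun x => c * g x).
Proof.
move=> [cf ig e]; split.
- by apply: within_continuousM => //; exact: cst_continuous.
- exact: (@integrableZl _ _ _ mu `]0, T[ _ c _ ig).
move=> s t s0 st tT.
have sub : `]s, t[ `<=` `]0, T[ by apply: subset_itvSoo; rewrite bnd_simp.
rewrite RintegralZl//; last exact: integrable_itvS sub ig.
by rewrite -e// mulrBr.
Qed.

Lemma primitive_on0 T : primitive_on T (fun=> 0) (fun=> 0).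
Proof.
split; [exact: cst_continuous| |].
- by apply: integrable_oo_continuous; exact: cst_continuous.
- by move=> s t _ _ _; rewrite Rintegral_cst// mul0r subrr.
Qed.

Lemma primitive_onD T f1 g1 f2 g2 :
  primitive_on T f1 g1 -> primitive_on T f2 g2 ->
  primitive_on T (fun x => f1 x + f2 x) (fun x => g1 x + g2 x).
Proof.
move=> p1 /(primitive_onZ (-1)) p2; have := primitive_onB p1 p2.
congr primitive_on; apply/funext => x; by rewrite mulN1r opprK.
Qed.

Lemma primitive_on_sum (I : finType) T (f g : I -> R -> R) :
  (forall k, primitive_on T (f k) (g k)) ->
  primitive_on T (fun x => \sum_k f k x) (fun x => \sum_k g k x).
Proof.
move=> fg.
rewrite /index_enum; elim: (Finite.enum _) => [|k r IH].
  have := primitive_on0 T; congr primitive_on;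
    by apply/funext => x; rewrite big_nil.
have := primitive_onD (fg k) IH; congr primitive_on;
  by apply/funext => x; rewrite big_cons.
Qed.

(** Near [x], [f] is a constant plus the integral of the continuous [g], so the fundamental theorem
    applies. This turns an equation valid almost everywhere into a classical one. *)
Lemma primitive_on_derive T f h g (al be : R) :
  primitive_on T f h -> {within `[0, T], continuous g} ->
  0 <= al -> be <= T -> ae_on T (fun t => al < t < be -> h t = g t) ->
  forall x, al < x < be -> is_derive x 1 f (g x).
Proof.
move=> [cf ih fh] cg al0 beT hg x /andP[alx xbe].
(* A base point for the integral and a right bound, leaving room on both sides of [x] inside []al,
   be[]. *)
pose s := (al + x) / 2; pose u := (x + be) / 2.
have [als sx] : al < s /\ s < x by rewrite /s; split; lra.
have [xu ube] : x < u /\ u < be by rewrite /u; split; lra.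
have s0 : 0 <= s by rewrite ltW// (le_lt_trans al0).
have cgsu y : y <= T -> {within `[s, y], continuous g}.
  by move=> yT; apply: continuous_subspaceW cg; apply: subset_itvScc; rewrite bnd_simp.
have igsu y : y <= T -> mu.-integrable `[s, y] (EFin \o g).
  move=> yT; apply: continuous_compact_integrable; first exact: segment_compact.
  exact: cgsu.
have cgx : {for x, continuous g}.
  apply: within_continuous_continuous cg _; first by lra.
  by rewrite in_itv/=; apply/andP; split; lra.
have uT : u <= T by lra.
have [dF FE] := @continuous_FTC1_closed _ g s x u xu (igsu _ uT) sx cgx.
have FD : is_derive x 1 (fun y => \int[mu]_(t in `[s, y]) g t) (g x).
  by split; [exact: dF|rewrite -derive1E].
have fD := is_deriveD FD (is_derive_cst (f s) x 1).
rewrite addr0 in fD.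
apply: near_eq_is_derive fD; near=> y.
have sy : s < y by near: y; exact: lt_nbhsr.
have ybe : y < be by near: y; exact: lt_nbhsl.
rewrite /= -[RHS](subrK (f s)) fh//; last by lra.
congr (_ + _).
have sub : `]s, y[ `<=` `[s, y] by exact: subset_itv_oo_cc.
have yT : y <= T by lra.
have ioo := integrable_itvS sub (igsu _ yT).
rewrite -Rintegral_itv_obnd_cbnd; last first.
  exact: integrable_itvS (@subset_itv_oc_cc _ _ s y) (igsu _ yT).
rewrite -Rintegral_itv_bndo_bndc; last exact: ioo.
congr fine; apply: ae_eq_integral => //.
- by have /integrableP[] := ioo.
- have sub' : `]s, y[ `<=` `]0, T[ by apply: subset_itvSoo; rewrite bnd_simp.
  by have /integrableP[] := integrable_itvS sub' ih.
rewrite /ae_eq. apply: (@filterS _ _ (ae_filter_ringOfSetsType mu) _ _ _ hg).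
move=> z hz /=; rewrite in_itv/= => /andP[sz zy].
by rewrite hz ?in_itv//=; apply/andP; split; lra.
Unshelve. all: by end_near. Qed.

Lemma is_derive_locally0 (f : R -> R) (al be l x : R) :
  (forall y, al < y < be -> f y = 0) -> al < x < be -> is_derive x 1 f l -> l = 0.
Proof.
move=> f0 /andP[alx xbe] fl.
have : is_derive x 1 f 0.
  apply: near_eq_is_derive (is_derive_cst 0 x 1); near=> y.
  rewrite f0//; apply/andP; split; near: y; [exact: lt_nbhsr|exact: lt_nbhsl].
by move=> f'0; rewrite -(@derive_val _ _ _ _ _ _ _ fl) (@derive_val _ _ _ _ _ _ _ f'0).
Unshelve. all: by end_near. Qed.

(** Grönwall: the energy [E], the sum of the [u k ^+ 2], satisfies [E' <= 2 b E], so
    [E x * expR (- 2 b x)] is nonincreasing, and it starts from 0. *)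
Lemma linear_ode_eq0 (I : finType) T (C : I -> I -> R) (u : I -> R -> R) :
  (forall k, {within `[0, T], continuous (u k)}) ->
  (forall k x, 0 < x < T -> is_derive x 1 (u k) (\sum_l C k l * u l x)) ->
  (forall k, u k 0 = 0) -> forall k x, 0 <= x <= T -> u k x = 0.
Proof.
move=> cu du u0.
pose b := \sum_k \sum_l `|C k l|.
have b0 : 0 <= b by apply: sumr_ge0 => k _; exact: sumr_ge0.
pose E x := \sum_k u k x * u k x.
pose dE x := \sum_k 2 * (u k x * \sum_l C k l * u l x).
have E0 x : 0 <= E x by apply: sumr_ge0 => k _; rewrite -expr2 sqr_ge0.
have uE k x : u k x ^+ 2 <= E x.
  by rewrite /E (bigD1 k)//= -expr2 lerDl sumr_ge0// => l _; rewrite -expr2 sqr_ge0.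
have dEle x : dE x <= 2 * b * E x.
  rewrite /dE -mulr_sumr -mulrA ler_pM2l// /b mulr_suml ler_sum// => k _.
  rewrite mulr_sumr mulr_suml ler_sum// => l _.
  apply: le_trans (ler_norm _) _; rewrite mulrCA normrM ler_wpM2l//.
  have := uE k x; have := uE l x; rewrite ler_norml => ? ?.
  (* These squares bound [|u k x * u l x|] by the mean of the two squared components, hence by
     [E x]. *)
  have := sqr_ge0 (u k x + u l x); have := sqr_ge0 (u k x - u l x) => ? ?.
  by apply/andP; split; nra.
have EE x : 0 < x < T -> is_derive x 1 E (dE x).
  move=> xT.
  apply: (@is_derive_finsum _ _ (fun k _ => 2 * (u k x * \sum_l C k l * u l x))) => k.
  by apply: (is_derive_eq (is_derive_mulr (du k x xT) (du k x xT))); ring.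
pose ex x : R := expR (- (2 * b) * x).
have exE x : is_derive x 1 ex (- (2 * b) * ex x).
  have d0 := is_derive_mulr (is_derive_cst (- (2 * b)) x (1 : R)) (is_derive_id x (1 : R)).
  have d1 := @is_derive1_comp _ expR (fun y => - (2 * b) * y) x _ _
    (is_derive_expR _) d0.
  by apply: (is_derive_eq d1); rewrite mulr1 mul0r addr0 mulrC.
pose G x := E x * ex x.
have GE x : 0 < x < T -> is_derive x 1 G ((dE x - 2 * b * E x) * ex x).
  by move=> xT; apply: (is_derive_eq (is_derive_mulr (EE x xT) (exE x))); ring.
have cE : {within `[0, T], continuous E}.
  by apply: within_continuous_sum => k; exact: within_continuousM.
have cG : {within `[0, T], continuous G}.
  apply: within_continuousM => //; apply: continuous_subspaceT.
  exact: is_derive_continuous exE.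
have Gle x : 0 <= x <= T -> G x <= G 0.
  move=> /andP[x0 xT].
  apply: (@ler0_derive1_le_cc _ G 0 T) => //.
  - by move=> y; rewrite in_itv => /GE/@ex_derive.
  - move=> y; rewrite in_itv => /GE hy; rewrite derive1E (@derive_val _ _ _ _ _ _ _ hy).
    by rewrite mulr_le0_ge0 ?expR_ge0// subr_le0.
  - by rewrite in_itv/= x0.
  - by rewrite in_itv/= lexx (le_trans x0).
move=> k x xT; apply/eqP; rewrite -sqrf_eq0 eq_le sqr_ge0 andbT.
apply: le_trans (uE k x) _.
rewrite -(pmulr_lle0 (E x) (expR_gt0 (- (2 * b) * x))).
apply: le_trans (Gle x xT) _.
by rewrite /G /E big1 ?mul0r// => l _; rewrite u0 mul0r.
Qed.

End Primitives.

Section Vanishing.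
Context {R : realType}.
Notation mu := (@lebesgue_measure R).
Implicit Types (T s t x : R) (f g u : R -> R).

(** All integrals of [g] from 0 vanish, and Lebesgue differentiation recovers [g] from them almost
    everywhere. *)
Lemma primitive_on_ae0 T f g :
  primitive_on T f g -> (forall t, 0 <= t <= T -> f t = 0) ->
  ae_on T (fun t => g t = 0).
Proof.
move=> [_ ig fg] f0.
(* Lebesgue differentiation is used for integrals from minus infinity, hence the extension of [g] by
   0. *)
have iG : mu.-integrable setT (EFin \o (g \_ `]0, T[)).
  by rewrite -restrict_EFin; apply/(integrable_mkcond _ _).1.
have iGy (y : R) : mu.-integrable `]-oo, y] (EFin \o (g \_ `]0, T[)).
  by apply: (@integrableS _ _ _ mu setT) iG => //; exact: measurable_itv.
have lG : locally_integrable setT (g \_ `]0, T[) by exact: integrable_locally.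
have := FTC1Ny iGy lG.
move=> hae; apply: (@filterS _ _ (ae_filter_ringOfSetsType mu) _ _ _ hae).
move=> x /= [dF FE] /[!in_itv]/= /andP[x0 xT].
have <- : (g \_ `]0, T[) x = g x by rewrite patchE mem_set//= in_itv/= x0.
rewrite -FE derive1E.
apply: (@is_derive_locally0 _ _ 0 T _ x _ _ (derivableP dF)); last by rewrite x0.
move=> y /andP[y0 yT].
rewrite -Rintegral_mkcondr.
have -> : `]-oo, y] `&` `]0, T[ = [set` `]0, y]].
  apply/seteqP; split => z /=; rewrite !in_itv/=.
    by move=> [zy /andP[-> _]].
  by move=> /andP[-> zy]; split => //=; exact: le_lt_trans yT.
have i0y : mu.-integrable `]0, y[ (EFin \o g).
  by apply: integrable_itvS ig; apply: subset_itvSoo; rewrite bnd_simp// ltW.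
by rewrite -Rintegral_itv_bndo_bndc// -fg ?lexx ?ltW//
  !f0 ?subrr ?lexx ?ltW// (lt_trans y0).
Qed.

(** Vanishing is obtained on open intervals, while the boundary terms of the integration by parts
    involve the value at [T]. *)
Lemma within_continuous_right0 T f (al : R) : 0 <= al -> al < T ->
  {within `[0, T], continuous f} -> (forall t, al < t < T -> f t = 0) -> f T = 0.
Proof.
move=> al0 alT cf f0; apply/eqP/negPn/negP => fT.
have e0 : 0 < `|f T| / 2 by rewrite divr_gt0// normr_gt0.
have TT : [set` `[0, T]] T by rewrite /= in_itv/= lexx andbT ltW// (le_lt_trans al0).
have [d /= d0 fd] := within_continuous_near cf TT e0.
(* The point [T - m / 2] lies in []al, T[] and close enough to [T] for [f] to differ from [f T] by
   at most half of [|f T|]. *)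
pose m := Num.min d (T - al).
have m0 : 0 < m by rewrite lt_min d0 subr_gt0.
have [md mT] : m <= d /\ m <= T - al by split; rewrite ge_min lexx ?orbT.
have := fd (T - m / 2); rewrite (f0 (T - m / 2)); last by apply/andP; split; lra.
rewrite subr0 /ball/= in_itv/= opprB addrCA subrr addr0 gtr0_norm ?divr_gt0//.
have mdT : m / 2 < d /\ 0 <= T - m / 2 <= T.
  by split; [lra|apply/andP; split; lra].
by case: mdT => -> -> /(_ isT isT) fTe; lra.
Qed.

End Vanishing.

(** * Vector-valued primitives and propagation of unseen components *)

Section VectorPrimitives.
Context {R : realType} {N : nat}.
Notation mu := (@lebesgue_measure R).
Implicit Types (T : R) (X DX : R -> 'cV[R]_N).

Definition vprimitive_on T X DX := forall k,
  primitive_on T (fun t => X t k ord0) (fun t => DX t k ord0).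

Lemma vprimitive_onB T X1 DX1 X2 DX2 :
  vprimitive_on T X1 DX1 -> vprimitive_on T X2 DX2 ->
  vprimitive_on T (fun t => X1 t - X2 t) (fun t => DX1 t - DX2 t).
Proof.
move=> p1 p2 k; have := primitive_onB (p1 k) (p2 k).
by congr primitive_on; apply/funext => t; rewrite !mxE.
Qed.

Lemma vprimitive_on_mulmx T (M : 'M[R]_N) X DX :
  vprimitive_on T X DX -> vprimitive_on T (fun t => M *m X t) (fun t => M *m DX t).
Proof.
move=> p k.
have := primitive_on_sum (fun l => primitive_onZ (M k l) (p l)).
by congr primitive_on; apply/funext => t; rewrite !mxE.
Qed.

Lemma vprimitive_on_continuous T X DX k : vprimitive_on T X DX ->
  {within `[0, T], continuous (fun t => X t k ord0)}.
Proof. by move=> /(_ k)[]. Qed.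

(* Differentiating (L^k Z)_o = 0 twice gives (L^(k+1) Z)_o + lam (L^k S)_o = 0. *)
Lemma unseen_source_eq0 T (L : 'M[R]_N) (lam : R -> R) (S : 'cV[R]_N)
    (Z DZ H : R -> 'cV[R]_N) (al be : R) (o : 'I_N) (n : nat) :
  vprimitive_on T Z DZ -> vprimitive_on T DZ H -> 0 <= al -> be <= T ->
  ae_on T (fun t => al < t < be -> H t = L *m Z t + lam t *: S) ->
  (forall t, al < t < be -> Z t o ord0 = 0) ->
  (forall k, (k < n)%N -> iter k (mulmx L) S o ord0 = 0) ->
  forall k, (k <= n)%N -> forall t, al < t < be ->
    iter k (mulmx L) (Z t) o ord0 = 0 /\ iter k (mulmx L) (DZ t) o ord0 = 0.
Proof.
move=> pZ pDZ al0 beT hH Z0 hS k kn.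
(* The first differentiation is classical because [DZ] is continuous. *)
have DP0 P : (forall t, al < t < be -> (P *m Z t) o ord0 = 0) ->
    forall t, al < t < be -> (P *m DZ t) o ord0 = 0.
  move=> PZ0 t tab; apply: is_derive_locally0 PZ0 (tab) _.
  apply: (@primitive_on_derive _ T _ _ (fun t => (P *m DZ t) o ord0) al be
    (vprimitive_on_mulmx P pZ o)) (tab) => //.
    exact: (vprimitive_on_continuous (vprimitive_on_mulmx P pDZ)).
  exact: aeW.
suff PZ0 : forall t, al < t < be -> (iter k (mulmx L) 1%:M *m Z t) o ord0 = 0.
  by move=> t tab; split; rewrite iter_mulmxE ?PZ0 ?DP0.
elim: k kn => [_ t tab|k IH kn t tab].
  by rewrite /= mul1mx Z0.
have {IH}PDZ0 := DP0 _ (IH (ltnW kn)).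
(* The extra factor [L] goes innermost, where the equation produces [L *m Z]; the source contributes
   [lam * (P *m S)_o], which is 0 because [k < n]. *)
rewrite -iter_mulmxE iterSr iter_mulmxE; set P := iter k (mulmx L) 1%:M.
apply: is_derive_locally0 PDZ0 (tab) _.
apply: (@primitive_on_derive _ T _ _ (fun t => (P *m (L *m Z t)) o ord0) al be
  (vprimitive_on_mulmx P pDZ o)) (tab) => //.
  exact: (vprimitive_on_continuous
    (vprimitive_on_mulmx P (vprimitive_on_mulmx L pZ))).
apply: (@filterS _ _ (ae_filter_ringOfSetsType mu) _ _ _ hH) => s hs sT sab.
by rewrite hs// mulmxDr -scalemxAr -(iter_mulmxE L k S) mxE [X in _ + X]mxE hS//
  mulr0 addr0.
Qed.

End VectorPrimitives.

(** * Sine coefficients *)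

Section SineTransform.
Context {R : realType}.
Notation mes := (@lebesgue_measure R).
Implicit Types (T s t x : R) (f g u : R -> R).

Lemma inner_sum (I : finType) T (c : I -> R) (f : I -> R -> R) u :
  (forall l, mes.-integrable `]0, T[ (EFin \o f l)) ->
  {within `[0, T], continuous u} ->
  inner T (fun t => \sum_l c l * f l t) u = \sum_l c l * inner T (f l) u.
Proof.
move=> fi cu; rewrite /index_enum.
suff : mes.-integrable `]0, T[
    (EFin \o (fun t => (\sum_(l <- Finite.enum I) c l * f l t) * u t)) /\
  inner T (fun t => \sum_(l <- Finite.enum I) c l * f l t) u =
    \sum_(l <- Finite.enum I) c l * inner T (f l) u by case.
rewrite /inner; elim: (Finite.enum _) => [|k r [IHi IHe]].
  have E : (fun t => (\sum_(l <- [::]) c l * f l t) * u t) = cst 0.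
    by apply/funext => t; rewrite big_nil mul0r.
  rewrite E big_nil Rintegral_cst// mul0r; split => //.
  by apply: integrable_oo_continuous; exact: cst_continuous.
have E : (fun t => (\sum_(l <- k :: r) c l * f l t) * u t) =
    (fun t => c k * (f k t * u t) + (\sum_(l <- r) c l * f l t) * u t).
  by apply/funext => t; rewrite big_cons mulrDl mulrA.
have ik := integrable_oo_mul (fi k) cu.
have ick : mes.-integrable `]0, T[ (EFin \o (fun t => c k * (f k t * u t))).
  exact: (@integrableZl _ _ _ mes `]0, T[ _ (c k) _ ik).
rewrite E; split.
  exact: (@integrableD _ _ _ mes `]0, T[ _ _ _ ick IHi).
by rewrite RintegralD// IHe RintegralZl// big_cons.
Qed.

Lemma inner_ae_eq T f g u :
  mes.-integrable `]0, T[ (EFin \o f) -> mes.-integrable `]0, T[ (EFin \o g) ->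
  {within `[0, T], continuous u} -> ae_on T (fun t => f t = g t) ->
  inner T f u = inner T g u.
Proof.
move=> fi gi cu fg; congr fine; apply: ae_eq_integral => //.
- by have /integrableP[] := integrable_oo_mul fi cu.
- by have /integrableP[] := integrable_oo_mul gi cu.
apply: (@filterS _ _ (ae_filter_ringOfSetsType mes) _ _ _ fg) => t /= fgt tT.
by rewrite fgt.
Qed.

Definition dphi T (m : nat) t : R :=
  Num.sqrt (2 / T) * (m%:R * pi / T * cos (m%:R * pi * t / T)).

Lemma is_derive_phase T (m : nat) t :
  is_derive t 1 (fun s => m%:R * pi * s / T) (m%:R * pi / T).
Proof.
have d1 := is_derive_mulr (is_derive_mulr (is_derive_cst (m%:R * pi) t (1 : R))
  (is_derive_id t (1 : R))) (is_derive_cst T^-1 t (1 : R)).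
by apply: (is_derive_eq d1) => /=; ring.
Qed.

Lemma is_derive_phi T m t : is_derive t 1 (phi T m) (dphi T m t).
Proof.
have d0 := is_derive_phase T m t.
have d2 := @is_derive1_comp _ sin (fun s => m%:R * pi * s / T) t _ _
  (is_derive_sin _) d0.
have d3 := is_derive_mulr (is_derive_cst (Num.sqrt (2 / T)) t (1 : R)) d2.
by apply: (is_derive_eq d3); rewrite /dphi /=; ring.
Qed.

Lemma is_derive_dphi T m t : is_derive t 1 (dphi T m) (- mu T m * phi T m t).
Proof.
have d0 := is_derive_phase T m t.
have d2 := @is_derive1_comp _ cos (fun s => m%:R * pi * s / T) t _ _
  (is_derive_cos _) d0.
have d3 := is_derive_mulr (is_derive_cst (m%:R * pi / T) t (1 : R)) d2.
have d4 := is_derive_mulr (is_derive_cst (Num.sqrt (2 / T)) t (1 : R)) d3.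
by apply: (is_derive_eq d4); rewrite /phi /mu /=; ring.
Qed.

Lemma phi0 T m : phi T m 0 = 0.
Proof. by rewrite /phi mulr0 mul0r sin0 mulr0. Qed.

Lemma phiT T m : 0 < T -> phi T m T = 0.
Proof.
move=> T0; rewrite /phi mulfK ?gt_eqF//.
suff -> : sin (m%:R * pi : R) = 0 by rewrite mulr0.
elim: m => [|m IH]; first by rewrite mul0r sin0.
by rewrite -natr1 mulrDl mul1r sinDpi IH oppr0.
Qed.

Lemma wave_solution_primitive T N (L : 'M[R]_N) a b lam S (X : R -> 'cV[R]_N) :
  wave_solution T L a b lam S X -> exists DX DDX : R -> 'cV[R]_N,
  [/\ vprimitive_on T X DX, vprimitive_on T DX DDX,
      ae_on T (fun t => DDX t - L *m X t = lam t *: S) & X 0 = a /\ DX 0 = b].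
Proof.
case=> DX [DDX [h1 c ode init]]; exists DX, DDX.
by split => // k; apply: H1_derivative_primitive;
  [exact: (c k).1|exact: (h1 k).1|exact: (c k).2|exact: (h1 k).2].
Qed.

(** Two integrations by parts move the second derivative onto [phi], an eigenfunction for [mu]; only
    the boundary terms in [dphi] survive, as [phi] vanishes at 0 and [T]. *)
Lemma wave_solution_sine_transform T N (L : 'M[R]_N) a b lam S
    (X : R -> 'cV[R]_N) (m : nat) (k : 'I_N) :
  0 < T -> L2 T lam -> wave_solution T L a b lam S X ->
  \sum_l L k l * inner T (fun t => X t l ord0) (phi T m) +
    mu T m * inner T (fun t => X t k ord0) (phi T m) =
  X 0 k ord0 * dphi T m 0 - X T k ord0 * dphi T m T -
    inner T lam (phi T m) * S k ord0.
Proof.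
move=> T0 /L2_integrable ilam [DX [DDX [h1 c ode init]]].
have cphi := is_derive_continuous (is_derive_phi T m).
have cphiT := @continuous_subspaceT _ _ `[0, T] _ cphi.
have cdphi := is_derive_continuous (is_derive_dphi T m).
have cddphi : continuous (fun t => - mu T m * phi T m t).
  by move=> t; apply: cvgM; [exact: cvg_cst|exact: cphi].
have [[_ /L2_integrable iDX wX] [_ /L2_integrable iDDX wDX]] := h1 k.
have := weak_derivative_by_parts T0 (c k).1 iDX wX (is_derive_dphi T m) cddphi.
have := weak_derivative_by_parts T0 (c k).2 iDDX wDX (is_derive_phi T m) cdphi.
rewrite phi0 phiT// !mulr0 subrr => /(canRL (addrK _)); rewrite sub0r => ->.
have iX l : mes.-integrable `]0, T[ (EFin \o (fun t => X t l ord0)).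
  by apply: integrable_oo_continuous; exact: (c l).1.
have -> : inner T (fun t => X t k ord0) (fun t => - mu T m * phi T m t) =
    - mu T m * inner T (fun t => X t k ord0) (phi T m).
  rewrite /inner -RintegralZl//; last exact: (integrable_oo_mul (iX k) cphiT).
  by apply: eq_Rintegral => t _; rewrite mulrCA.
have -> : inner T (fun t => DDX t k ord0) (phi T m) =
    \sum_l L k l * inner T (fun t => X t l ord0) (phi T m) +
    inner T lam (phi T m) * S k ord0.
  (* One extra index carries the source, so that [L X + lam S] is a single linear combination. *)
  pose c' (l : 'I_N + 'I_1) := if l is inl l then L k l else S k ord0.
  pose f (l : 'I_N + 'I_1) := if l is inl l then (fun t => X t l ord0) else lam.
  have fi l : mes.-integrable `]0, T[ (EFin \o f l) by case: l => [l|] /=.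
  have -> : inner T (fun t => DDX t k ord0) (phi T m) =
      inner T (fun t => \sum_l c' l * f l t) (phi T m).
    apply: inner_ae_eq => //.
    - have := @integrable_sum _ _ _ mes `]0, T[ _ _ (index_enum ('I_N + 'I_1)%type) xpredT
        (fun l t => (c' l * f l t)%:E).
      have -> : (fun t => (\sum_l (c' l * f l t)%:E)%E) =
        EFin \o (fun t => \sum_l c' l * f l t).
        by apply/funext => t; rewrite /= sumEFin.
      apply => // l _.
      exact: (@integrableZl _ _ _ mes `]0, T[ _ (c' l) _ (fi l)).
    - apply: (@filterS _ _ (ae_filter_ringOfSetsType mes) _ _ _ ode) => t ht tT.
      have /(congr1 (fun M : 'cV_N => M k ord0)) := ht tT.
      rewrite !mxE => /eqP; rewrite subr_eq => /eqP ->.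
      by rewrite big_sumType /= big_ord1 addrC mulrC.
  by rewrite inner_sum// big_sumType /= big_ord1 (mulrC (S k ord0)).
lra.
Qed.

End SineTransform.

(** * Identification of the source *)

Section SourceIdentification.
Context {R : realType} {N : nat} (T : R) (L : 'M[R]_N).
Notation mes := (@lebesgue_measure R).

(* With r minimal such that the source is seen through component o by L^r, the
   matrix M annihilates S and fixes Z', so Z solves the unforced linear system
   Z'' = M L Z with zero initial data. *)
Lemma visible_source_eq0 (lam : R -> R) (S : 'cV[R]_N) (Z DZ H : R -> 'cV[R]_N)
    (o : 'I_N) (r : nat) :
  vprimitive_on T Z DZ -> vprimitive_on T DZ H ->
  ae_on T (fun t => H t = L *m Z t + lam t *: S) ->
  Z 0 = 0 -> DZ 0 = 0 -> (forall t, 0 < t < T -> Z t o ord0 = 0) ->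
  iter r (mulmx L) S o ord0 != 0 ->
  forall k t, 0 <= t <= T -> Z t k ord0 = 0 /\ DZ t k ord0 = 0.
Proof.
move=> pZ pDZ ode Z0 DZ0 oZ; elim/ltn_ind: r => r IH hr.
(* If a smaller power already sees the source, the induction hypothesis concludes; otherwise [r] is
   minimal. *)
have [/existsP[q /IH]|] := boolP [exists q : 'I_r, iter q (mulmx L) S o ord0 != 0].
  exact.
rewrite negb_exists => /forallP hS.
have ode' : ae_on T (fun t => 0 < t < T -> H t = L *m Z t + lam t *: S).
  apply: (@filterS _ _ (ae_filter_ringOfSetsType mes) _ _ _ ode) => t ht tT _.
  exact: ht.
have unseen : forall t, 0 < t < T -> (iter r (mulmx L) 1%:M *m DZ t) o ord0 = 0.
  move=> t tT; rewrite -iter_mulmxE.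
  apply: (unseen_source_eq0 pZ pDZ _ _ ode' oZ _ (leqnn r) tT).2 => // k kr.
  by apply/eqP; rewrite -[_ == _]negbK; have := hS (Ordinal kr).
set P := iter r (mulmx L) 1%:M in unseen.
(* The projection along [S] onto the kernel of the functional sending [w] to [(L^r w)_o]. *)
pose M : 'M[R]_N := 1%:M - (iter r (mulmx L) S o ord0)^-1 *: (S *m row o P).
have MS : M *m S = 0.
  rewrite mulmxBl mul1mx -scalemxAl -mulmxA.
  have -> : row o P *m S = (iter r (mulmx L) S o ord0)%:M.
    by rewrite -row_mul -iter_mulmxE [LHS]mx11_scalar mxE.
  by rewrite mul_mx_scalar scalerA mulVf// scale1r subrr.
have MDZ t : 0 < t < T -> M *m DZ t = DZ t.
  move=> tT; rewrite mulmxBl mul1mx -scalemxAl -mulmxA.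
  have -> : row o P *m DZ t = 0.
    by rewrite -row_mul [LHS]mx11_scalar mxE unseen// raddf0.
  by rewrite mulmx0 scaler0 subr0.
(* First-order form of the system for the pair [(Z, DZ)]. *)
pose u (k : 'I_N + 'I_N) t :=
  match k with inl k => Z t k ord0 | inr k => DZ t k ord0 end.
pose C (k l : 'I_N + 'I_N) := match k, l with
  | inl k, inr l => (k == l)%:R
  | inr k, inl l => (M *m L) k l
  | _, _ => 0 end.
have u0 : forall k t, 0 <= t <= T -> u k t = 0.
  apply: (@linear_ode_eq0 _ _ T C).
  - by case=> k;
      [exact: vprimitive_on_continuous pZ|exact: vprimitive_on_continuous pDZ].
  - case=> k t tT; rewrite big_sumType /=.
    + rewrite big1 => [|l _]; last by rewrite mul0r.
      rewrite add0r (bigD1 k)//= eqxx mul1r big1 ?addr0 => [|l lk]; last first.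
        by rewrite eq_sym (negbTE lk) mul0r.
      apply: (@primitive_on_derive _ T _ _ (fun t => DZ t k ord0) 0 T (pZ k)) => //.
        exact: vprimitive_on_continuous pDZ.
      exact: aeW.
    + rewrite [X in _ + X]big1 => [|l _]; last by rewrite mul0r.
      rewrite addr0.
      have -> : \sum_l (M *m L) k l * Z t l ord0 = (M *m (L *m Z t)) k ord0.
        by rewrite mulmxA [RHS]mxE.
      (* [DZ] coincides with [M *m DZ] on the open interval, and the derivative of the latter no
         longer contains the source. *)
      have : is_derive t 1 (fun s => (M *m DZ s) k ord0) ((M *m (L *m Z t)) k ord0).
        apply: (@primitive_on_derive _ T _ _ (fun t => (M *m (L *m Z t)) k ord0) 0 T
          (vprimitive_on_mulmx M pDZ k)) => //.
          exact: (vprimitive_on_continuous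
            (vprimitive_on_mulmx M (vprimitive_on_mulmx L pZ))).
        apply: (@filterS _ _ (ae_filter_ringOfSetsType mes) _ _ _ ode') => s hs sT s0T.
        by rewrite hs// mulmxDr -scalemxAr MS scaler0 addr0.
      have /andP[t0 tT'] := tT.
      apply: near_eq_is_derive; near=> s; rewrite MDZ//.
      by apply/andP; split; near: s; [exact: lt_nbhsr|exact: lt_nbhsl].
  - by case=> k; rewrite /= ?Z0 ?DZ0 mxE.
by move=> k t tT; split; [exact: (u0 (inl k))|exact: (u0 (inr k))].
Unshelve. all: by end_near. Qed.

End SourceIdentification.

Theorem theorem4p3 (R : realType) (T : R) (hT : 0 < T)
  (N : nat) (e : rel 'I_N) (he : simple_graph e)
  (omega : 'I_N -> R) (v : 'I_N -> 'cV[R]_N)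
  (hv : spectral_basis (laplacian e) omega v)
  (a b : 'cV[R]_N)
  (m : nat) (hm : (0 < m)%N)
  (i j : 'I_N) (hij : i <> j)
  (hstrat : strategic v [set i; j]%SET)
  (hinv : two_row_minors_invertible (laplacian e + (mu T m)%:M) i j)
  (lam1 lam2 : R -> R) (S1 S2 : 'cV[R]_N)
  (hadm1 : admissible T lam1 S1) (hadm2 : admissible T lam2 S2)
  (hphi1 : inner T lam1 (phi T m) <> 0)
  (hphi2 : inner T lam2 (phi T m) <> 0)
  (X1 X2 : R -> 'cV[R]_N)
  (hX1 : wave_solution T (laplacian e) a b lam1 S1 X1)
  (hX2 : wave_solution T (laplacian e) a b lam2 S2 X2)
  (hobs : forall t : R, 0 < t < T ->
     X1 t i ord0 = X2 t i ord0 /\ X1 t j ord0 = X2 t j ord0) :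
  S1 = S2 /\ ae_on T (fun t => lam1 t = lam2 t).
Proof.
set L := laplacian e in hv hinv hX1 hX2.
have [L2lam1 [T1 [/andP[T1_gt0 T1T] lam1_0]] S1_01 S1_sum] := hadm1.
have [L2lam2 [T2 [/andP[T2_gt0 T2T] lam2_0]] S2_01 S2_sum] := hadm2.
have [DX1 [DDX1 [pX1 pDX1 ode1 [X1_0 DX1_0]]]] := wave_solution_primitive hX1.
have [DX2 [DDX2 [pX2 pDX2 ode2 [X2_0 DX2_0]]]] := wave_solution_primitive hX2.
have pZ := vprimitive_onB pX1 pX2.
have pDZ := vprimitive_onB pDX1 pDX2.
set Z := fun t => X1 t - X2 t in pZ.
set DZ := fun t => DX1 t - DX2 t in pZ pDZ.
set H := fun t => DDX1 t - DDX2 t in pDZ.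
have odeZ : ae_on T (fun t => H t = L *m Z t + (lam1 t *: S1 - lam2 t *: S2)).
  apply: (@filterS2 _ _ (ae_filter_ringOfSetsType lebesgue_measure) _ _ _ _ ode1 ode2).
  move=> t h1 h2 tT; rewrite -h1// -h2// /H /Z mulmxBr.
  by apply/colP => k; rewrite !mxE; ring.
have obsZ o : o \in [set i; j]%SET -> forall t, 0 < t < T -> Z t o ord0 = 0.
  move=> + t tT; have [Xi Xj] := hobs _ tT.
  by rewrite !inE /Z => /orP[]/eqP ->; rewrite !mxE ?Xi ?Xj subrr.
have ZT : Z T = 0.
  pose T' := Num.max T1 T2.
  have T'T : T' < T by rewrite gt_max T1T.
  have T'0 : 0 <= T' by rewrite le_max ltW.
  have Zend t : T' < t < T -> Z t = 0.
    move=> tT; apply: (strategic_observable hv hstrat) => n o oij.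
    (* Past [T'] both sources are off. With the source taken to be 0, its orbit is unseen to every
       order, so every [n] is allowed. *)
    apply: (@unseen_source_eq0 _ _ T L (cst 0) 0 Z DZ H T' T o n pZ pDZ T'0 (lexx T)
      _ _ _ n (leqnn n) t tT).1.
    - apply: (@filterS3 _ _ (ae_filter_ringOfSetsType lebesgue_measure)
        _ _ _ _ _ odeZ lam1_0 lam2_0) => s hs s1 s2 sT /andP[T's _].
      move: T's; rewrite gt_max => /andP[T1s T2s].
      by rewrite hs// s1// s2// !scale0r subrr.
    - move=> s /andP[T's sT]; apply: obsZ => //.
      by rewrite sT andbT (le_lt_trans T'0).
    - by move=> k _; rewrite iter_mulmxE mulmx0 mxE.
  apply/colP => k; rewrite [RHS]mxE.
  apply: (@within_continuous_right0 _ T (fun t => Z t k ord0) T' T'0 T'T).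
    exact: vprimitive_on_continuous pZ.
  by move=> t /Zend ->; rewrite mxE.
have S12 : S1 = S2.
  have [p S1E] := source_indicator S1_01 S1_sum.
  have [q S2E] := source_indicator S2_01 S2_sum.
  rewrite S1E S2E; have [->//|pq] := eqVneq p q.
  (* The sine coefficients of [Z], kept as differences so that the transform applies to each
     solution separately. *)
  pose z : 'cV[R]_N := \col_k (inner T (fun t => X1 t k ord0) (phi T m) -
    inner T (fun t => X2 t k ord0) (phi T m)).
  have zlE k : z k ord0 = inner T (fun t => X1 t k ord0) (phi T m) -
      inner T (fun t => X2 t k ord0) (phi T m) by rewrite mxE.
  have zE k : ((L + (mu T m)%:M) *m z) k ord0 =
      inner T lam2 (phi T m) * S2 k ord0 - inner T lam1 (phi T m) * S1 k ord0.
    have F1 := wave_solution_sine_transform m k hT L2lam1 hX1.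
    have F2 := wave_solution_sine_transform m k hT L2lam2 hX2.
    (* Equal values at [T] and equal initial data cancel the boundary terms in the difference. *)
    have XT : X1 T = X2 T by apply/eqP; rewrite -subr_eq0; apply/eqP.
    rewrite X1_0 XT in F1; rewrite X2_0 in F2.
    have -> : ((L + (mu T m)%:M) *m z) k ord0 =
        \sum_l L k l * z l ord0 + mu T m * z k ord0.
      by rewrite mulmxDl mul_scalar_mx mxE; congr (_ + _); rewrite mxE.
    under eq_bigr => l _ do rewrite (zlE l) mulrBr.
    by rewrite sumrB zlE; lra.
  have z_obs o : o \in [set i; j]%SET -> z o ord0 = 0.
    move=> oij; rewrite zlE; apply/eqP; rewrite subr_eq0; apply/eqP.
    apply: eq_Rintegral => t; rewrite inE/= in_itv/= => tT.
    by have := obsZ _ oij _ tT; rewrite !mxE => /eqP; rewrite subr_eq0 => /eqP ->.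
  have z0 : z = 0.
    apply: (two_row_minors_eq0 _ pq hinv).
    - exact/eqP.
    - by apply: z_obs; rewrite !inE eqxx.
    - by apply: z_obs; rewrite !inE eqxx orbT.
    - move=> k kp kq; rewrite zE S1E S2E !mxE (negbTE kp) (negbTE kq).
      by rewrite !mulr0 subrr.
  (* Row [p] meets only the first source, and with [z = 0] it reads [inner T lam1 (phi T m) = 0]. *)
  have := zE p; rewrite z0 mulmx0 S1E S2E !mxE !eqxx (negbTE pq) /=.
  by rewrite mulr0 mulr1 sub0r => /esym/eqP; rewrite oppr_eq0 => /eqP/hphi1.
split => //; rewrite -{}S12 in odeZ.
have {}odeZ : ae_on T (fun t => H t = L *m Z t + (lam1 t - lam2 t) *: S1).
  apply: (@filterS _ _ (ae_filter_ringOfSetsType lebesgue_measure) _ _ _ odeZ).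
  by move=> t ht tT; rewrite scalerBl ht.
have [p S1E] := source_indicator S1_01 S1_sum.
have Z0 : Z 0 = 0 by rewrite /Z X1_0 X2_0 subrr.
have DZ0 : DZ 0 = 0 by rewrite /DZ DX1_0 DX2_0 subrr.
(* A source whose orbit is nowhere seen would be 0 by observability, contradicting that its entries
   sum to 1. *)
have [r [q qij hr]] : exists r, exists2 q, q \in [set i; j]%SET &
    iter r (mulmx L) S1 q ord0 != 0.
  apply: contrapT => nvis.
  have S1_0 : S1 = 0.
    apply: (strategic_observable hv hstrat) => n o oij.
    apply: contrapT => /eqP So; apply: nvis.
    by exists n, o.
  by move: S1_sum => /eqP; rewrite S1_0 big1 => [|k _]; rewrite ?mxE// eq_sym oner_eq0.
have vis := visible_source_eq0 pZ pDZ odeZ Z0 DZ0 (obsZ _ qij) hr.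
(* At the source node [p], where [S1] equals 1, the equation reduces to [0 = lam1 - lam2] almost
   everywhere. *)
have Hp0 := primitive_on_ae0 (pDZ p) (fun t tT => (vis p t tT).2).
apply: (@filterS2 _ _ (ae_filter_ringOfSetsType lebesgue_measure) _ _ _ _ odeZ Hp0).
move=> t ht Ht tT; have tT' : 0 <= t <= T.
  by move: tT; rewrite in_itv/= => /andP[/ltW -> /ltW ->].
have := Ht tT; rewrite ht//.
have -> : Z t = 0 by apply/colP => k; rewrite (vis k t tT').1 mxE.
by rewrite mulmx0 add0r S1E !mxE !eqxx mulr1 => /eqP; rewrite subr_eq0 => /eqP.
Qed.
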